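(* Let $i\geqslant 1$, let $L\subseteq A^*$ be a regular language and let $\alpha:A^*\to M$ be its syntactic morphism, where $M$ is the syntactic ordered monoid of $L$ with order $\leqslant$. Then $L$ is definable in $\Sigma_i(<)$ if and only if $$s^{\omega}\leqslant s^{\omega}\,t\,s^{\omega}\quad\text{for all }(t,s)\in\mathcal C_{i-1}[\alpha].$$
   Context: $A$ is a finite alphabet. Words over $A$ (including the empty word) are viewed as logical structures with positions linearly ordered by $<$ and labeled by letters; $\mathrm{FO}(<)$ uses unary predicates $P_a$ ($a\in A$) and the binary predicate $<$. A formula is $\Sigma_i(<)$ if its prenex normal form has either exactly $i$ quantifier blocks, the first one existential, or strictly fewer than $i$ blocks. A language is definable in $\Sigma_i(<)$ if it is $\{w\in A^*\mid w\models\varphi\}$ for some $\Sigma_i(<)$ sentence $\varphi$. The quantifier rank of a formula is the length of its longest sequence of nested quantifiers. For $i\ge 1$, $k\in\mathbb N$ and $w,w'\in A^*$, write $w\lesssim^k_i w'$ if every $\Sigma_i(<)$ sentence of quantifier rank at most $k$ satisfied by $w$ is also satisfied by $w'$ (formulas need not be literally prenex). For a morphism $\alpha:A^*\to M$ into a finite monoid, a chain is a finite sequence $(s_1,\dots,s_n)$ of elements of $M$. For $i\ge1$, $\mathcal C_i^k[\alpha]$ is the set of chains $(s_1,\dots,s_n)$ for which there are $w_1,\dots,w_n\in A^*$ with $w_1\lesssim^k_i\cdots\lesssim^k_i w_n$ and $\alpha(w_j)=s_j$ for all $j$; and $\mathcal C_i[\alpha]=\bigcap_{k}\mathcal C_i^k[\alpha]$.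 By convention $\mathcal C_0[\alpha]=M^*$ is the set of all chains. The syntactic preorder of $L$: $w\leqslant_L w'$ iff for all $u,v\in A^*$, $uwv\in L\Rightarrow uw'v\in L$. The syntactic ordered monoid of $L$ is the quotient of $A^*$ by the equivalence induced by $\leqslant_L$, with the induced partial order $\leqslant$; the syntactic morphism is the quotient map. $\omega\geqslant 1$ denotes an integer such that $s^\omega$ is idempotent for every $s\in M$. *)

(* Defs.v *)
From HB Require Import structures.
From mathcomp Require Import all_boot all_order.
From mathcomp Require Import boolp classical_sets.

Set Implicit Arguments.
Unset Strict Implicit.
Unset Printing Implicit Defensive.

Local Open Scope classical_set_scope.

Inductive quant := Ex | All.

Definition dual (q : quant) : quant := if q is Ex then All else Ex.

(* [fo A n]: formulas whose free variables are among n de Bruijn variables;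
   under a quantifier, variable [ord0] is the newly bound one.  The constants
   [Tru] and [Fls] are needed: without them no quantifier-free sentence exists,
   and the empty word satisfies no existential sentence. *)
Inductive fo (A : finType) : nat -> Type :=
| Tru n : fo A n
| Fls n : fo A n
| Lab n : A -> 'I_n -> fo A n
| Lt n : 'I_n -> 'I_n -> fo A n
| Not n : fo A n -> fo A n
| And n : fo A n -> fo A n -> fo A n
| Or n : fo A n -> fo A n -> fo A n
| Quant n : quant -> fo A n.+1 -> fo A n.

Arguments Tru {A n}.
Arguments Fls {A n}.

Definition sentence (A : finType) := fo A 0.

Fixpoint sat (A : finType) (w : seq A) n (f : fo A n) :
    n.-tuple 'I_(size w) -> bool :=
  match f in fo _ n return n.-tuple 'I_(size w) -> bool with
  | Tru _ => fun=> true
  | Fls _ => fun=> false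
  | Lab _ a x => fun v => tnth (in_tuple w) (tnth v x) == a
  | Lt _ x y => fun v => (tnth v x < tnth v y)%N
  | Not _ f => fun v => ~~ sat f v
  | And _ f g => fun v => sat f v && sat g v
  | Or _ f g => fun v => sat f v || sat g v
  | Quant _ Ex f => fun v => [exists p, sat f (cons_tuple p v)]
  | Quant _ All f => fun v => [forall p, sat f (cons_tuple p v)]
  end.

Definition models (A : finType) (w : seq A) (f : sentence A) : bool :=
  sat f (nil_tuple 'I_(size w)).

Fixpoint qrank (A : finType) n (f : fo A n) : nat :=
  match f with
  | Tru _ | Fls _ | Lab _ _ _ | Lt _ _ _ => 0
  | Not _ f => qrank f
  | And _ f g | Or _ f g => maxn (qrank f) (qrank g)
  | Quant _ _ f => (qrank f).+1
  end.

Fixpoint qfree (A : finType) n (f : fo A n) : bool :=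
  match f with
  | Tru _ | Fls _ | Lab _ _ _ | Lt _ _ _ => true
  | Not _ f => qfree f
  | And _ f g | Or _ f g => qfree f && qfree g
  | Quant _ _ _ => false
  end.

Definition lift_var m n (r : 'I_m -> 'I_n) (x : 'I_m.+1) : 'I_n.+1 :=
  if unlift ord0 x is Some y then lift ord0 (r y) else ord0.

Fixpoint rename (A : finType) m (f : fo A m) :
    forall n, ('I_m -> 'I_n) -> fo A n :=
  match f in fo _ m return forall n, ('I_m -> 'I_n) -> fo A n with
  | Tru _ => fun n _ => Tru
  | Fls _ => fun n _ => Fls
  | Lab _ a x => fun n r => Lab a (r x)
  | Lt _ x y => fun n r => Lt A (r x) (r y)
  | Not _ f => fun n r => Not (rename f r)
  | And _ f g => fun n r => And (rename f r) (rename g r)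
  | Or _ f g => fun n r => Or (rename f r) (rename g r)
  | Quant _ q f => fun n r => Quant q (rename f (lift_var r))
  end.

(* Weakening by one fresh variable, so that a quantifier can be moved across. *)
Definition shift (A : finType) n (f : fo A n) : fo A n.+1 :=
  rename f (lift ord0).

Fixpoint prenex_not (A : finType) n (f : fo A n) : fo A n :=
  match f in fo _ n return fo A n with
  | Quant _ q f => Quant (dual q) (prenex_not f)
  | f => Not f
  end.

Definition connective (A : finType) (conj : bool) n (f g : fo A n) : fo A n :=
  if conj then And f g else Or f g.

(* [prenex_bin c f g h]: h is obtained from the conjunction/disjunction of the
   prenex formulas f and g by pulling out their quantifiers one by one, in some
   order (the quantifiers of f and of g may be interleaved arbitrarily). *)
Inductive prenex_bin (A : finType) (c : bool) :
    forall n, fo A n -> fo A n -> fo A n -> Prop :=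
| PB_matrix n (f g : fo A n) :
    qfree f -> qfree g -> prenex_bin c f g (connective c f g)
| PB_left n q (f : fo A n.+1) (g : fo A n) (h : fo A n.+1) :
    prenex_bin c f (shift g) h -> prenex_bin c (Quant q f) g (Quant q h)
| PB_right n q (f : fo A n) (g : fo A n.+1) (h : fo A n.+1) :
    prenex_bin c (shift f) g h -> prenex_bin c f (Quant q g) (Quant q h).

Inductive prenex_nf (A : finType) : forall n, fo A n -> fo A n -> Prop :=
| PN_qfree n (f : fo A n) : qfree f -> prenex_nf f f
| PN_not n (f h : fo A n) : prenex_nf f h -> prenex_nf (Not f) (prenex_not h)
| PN_bin c n (f g f' g' h : fo A n) :
    prenex_nf f f' -> prenex_nf g g' -> prenex_bin c f' g' h ->
    prenex_nf (connective c f g) h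
| PN_quant n q (f h : fo A n.+1) :
    prenex_nf f h -> prenex_nf (Quant q f) (Quant q h).

Fixpoint prefix (A : finType) n (f : fo A n) : seq quant :=
  if f is Quant _ q f then q :: prefix f else [::].

Fixpoint nblocks (s : seq quant) : nat :=
  match s with
  | [::] => 0
  | q :: s' => match q, s' with
               | Ex, Ex :: _ | All, All :: _ => nblocks s'
               | _, _ => (nblocks s').+1
               end
  end.

(* Prenex normal forms depend on the order in which quantifiers are pulled out;
   f is Sigma_i when one of them has the required shape.  This is a syntactic
   condition on f: f and its prenex normal forms may disagree on the empty word,
   and only f itself is ever evaluated. *)
Definition Sigma (A : finType) (i : nat) n (f : fo A n) : Prop :=
  exists h : fo A n, prenex_nf f h /\
    (nblocks (prefix h) = i /\ ohead (prefix h) = Some Ex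
     \/ (nblocks (prefix h) < i)%N).

Definition Sigma_definable (A : finType) (i : nat) (L : set (seq A)) : Prop :=
  exists f : sentence A, Sigma i f /\ L = [set w | models w f].

Definition lesssim (A : finType) (k i : nat) (w w' : seq A) : Prop :=
  forall f : sentence A,
    Sigma i f -> (qrank f <= k)%N -> models w f -> models w' f.

Definition chains_rank (A : finType) (M : Type) (alpha : seq A -> M)
    (i k : nat) : set (seq M) :=
  [set c | exists ws : seq (seq A),
     (forall j, (j.+1 < size ws)%N ->
        lesssim k i (nth [::] ws j) (nth [::] ws j.+1))
     /\ map alpha ws = c].

Definition chains (A : finType) (M : Type) (alpha : seq A -> M)
    (i : nat) : set (seq M) :=
  if i is 0 then setT else \bigcap_k chains_rank alpha i k.

Definition regular (A : finType) (L : set (seq A)) : Prop :=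
  exists (Q : finType) (q0 : Q) (delta : Q -> A -> Q) (F : pred Q),
    L = [set w | F (foldl delta q0 w)].

Definition syn_le (A : finType) (L : set (seq A)) (w w' : seq A) : Prop :=
  forall u v : seq A, L (u ++ w ++ v) -> L (u ++ w' ++ v).

Definition syn_equiv (A : finType) (L : set (seq A)) : rel (seq A) :=
  fun w w' => `[< syn_le L w w' /\ syn_le L w' w >].

Section SyntacticMonoid.
Variables (A : finType) (L : set (seq A)).

Lemma syn_le_refl w : syn_le L w w.
Proof. by []. Qed.

Lemma syn_le_trans w2 w1 w3 : syn_le L w1 w2 -> syn_le L w2 w3 -> syn_le L w1 w3.
Proof. by move=> h12 h23 u v /h12 /h23. Qed.

Lemma syn_le_cat w1 w1' w2 w2' :
  syn_le L w1 w1' -> syn_le L w2 w2' -> syn_le L (w1 ++ w2) (w1' ++ w2').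
Proof.
move=> h1 h2 u v; rewrite -!catA => /h1.
by rewrite catA => /h2; rewrite -catA.
Qed.

Lemma syn_equiv_refl : reflexive (syn_equiv L).
Proof. by move=> w; apply/asboolP; split=> u v. Qed.

Lemma syn_equiv_sym : symmetric (syn_equiv L).
Proof. by move=> w w'; apply/asboolP/asboolP => -[]. Qed.

Lemma syn_equiv_trans : transitive (syn_equiv L).
Proof.
move=> w2 w1 w3 /asboolP[h12 h21] /asboolP[h23 h32].
by apply/asboolP; split; apply: syn_le_trans; eassumption.
Qed.

Canonical syn_equiv_rel :=
  EquivRel (syn_equiv L) syn_equiv_refl syn_equiv_sym syn_equiv_trans.

Definition synt : Type := {eq_quot syn_equiv_rel}%qT.
HB.instance Definition _ : EqQuotient _ syn_equiv_rel synt := EqQuotient.on synt.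
HB.instance Definition _ := Choice.on synt.

Definition synt_morph (w : seq A) : synt := (\pi_synt w)%qT.

Definition synt_mul (x y : synt) : synt := synt_morph (repr x ++ repr y).

Definition synt_le (x y : synt) : bool := `[< syn_le L (repr x) (repr y) >].

Lemma synt_morphE w w' :
  synt_morph w = synt_morph w' <-> syn_le L w w' /\ syn_le L w' w.
Proof.
split=> [/eqP|h]; first by rewrite /synt_morph eqquotE => /asboolP.
by apply/eqP; rewrite /synt_morph eqquotE; apply/asboolP.
Qed.

Lemma synt_morph_repr x : synt_morph (repr x) = x.
Proof. exact: reprK. Qed.

Lemma repr_synt_morph w :
  syn_le L (repr (synt_morph w)) w /\ syn_le L w (repr (synt_morph w)).
Proof. by apply/synt_morphE; rewrite synt_morph_repr. Qed.

Lemma synt_mulE w w' :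
  synt_mul (synt_morph w) (synt_morph w') = synt_morph (w ++ w').
Proof.
have [h1 h2] := repr_synt_morph w; have [h3 h4] := repr_synt_morph w'.
by apply/synt_morphE; split; apply: syn_le_cat.
Qed.

Lemma synt_mulA : associative synt_mul.
Proof.
move=> x y z; rewrite -(synt_morph_repr x) -(synt_morph_repr y).
by rewrite -(synt_morph_repr z) !synt_mulE catA.
Qed.

Lemma synt_mul1 : left_id (synt_morph [::]) synt_mul.
Proof. by move=> x; rewrite -(synt_morph_repr x) synt_mulE. Qed.

Lemma synt_mulr1 : right_id (synt_morph [::]) synt_mul.
Proof. by move=> x; rewrite -(synt_morph_repr x) synt_mulE cats0. Qed.

HB.instance Definition _ :=
  isMonoid.Build synt synt_mulA synt_mul1 synt_mulr1.

Lemma synt_le_refl : reflexive synt_le.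
Proof. by move=> x; apply/asboolP => u v. Qed.

Lemma synt_le_anti : antisymmetric synt_le.
Proof.
move=> x y /andP[/asboolP hxy /asboolP hyx].
by rewrite -(synt_morph_repr x) -(synt_morph_repr y); apply/synt_morphE.
Qed.

Lemma synt_le_trans : transitive synt_le.
Proof.
move=> y x z /asboolP hxy /asboolP hyz.
by apply/asboolP; apply: syn_le_trans hxy hyz.
Qed.

Fact synt_display : Order.disp_t. Proof. exact: Order.Disp tt tt. Qed.

HB.instance Definition _ := Order.Le_isPOrder.Build synt_display synt
  synt_le_refl synt_le_anti synt_le_trans.

Lemma synt_morph1 : synt_morph [::] = 1%g.
Proof. by []. Qed.

Lemma synt_morphM w w' : synt_morph (w ++ w') = (synt_morph w * synt_morph w')%g.
Proof. by rewrite -synt_mulE. Qed.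

Lemma synt_leP w w' : (synt_morph w <= synt_morph w')%O <-> syn_le L w w'.
Proof.
have [h1 h2] := repr_synt_morph w; have [h3 h4] := repr_synt_morph w'.
split=> [/asboolP h|h].
  exact: syn_le_trans h2 (syn_le_trans h h3).
apply/asboolP; exact: syn_le_trans h1 (syn_le_trans h h4).
Qed.

End SyntacticMonoid.

(* Main.v *)
Require Import Defs.
From HB Require Import structures.
From mathcomp Require Import all_boot all_order.
From mathcomp Require Import boolp classical_sets.
From mathcomp Require Import zify.

(* Logic is replaced by an Ehrenfeucht-Fraisse game: [L] is [Sigma_i]-definable
   iff it is closed under the [i]-th game preorder with [k] rounds, for some [k].
   If [u] is below [v] for level [i-1], then [v^N] is below [v^N u v^N] for level
   [i]; this gives the inequality.

   Conversely, call [w] good at rank [k] if the value of any word above [w] is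
   above the value of [w].  Good words are closed under concatenation, and
   [x u y] is good if [x] and [y] are and the value [s] of [u] satisfies
   [x s = x], [s y = y]: in a word [x' u' y'] above it, [u'] is below [u] for level
   [i-1], so [x y = x s^omega y <= x s^omega u' s^omega y = x u' y <= x' u' y'].
   Only the two outer factors have to be good, so a weak substitute for Simon's
   factorization forests suffices: every word is obtained from letters by these
   two operations in bounded depth.  This goes by induction on the size of the
   two-sided ideal of the value of [w]: cut [w] after the shortest prefix [p] with
   that ideal, then let [u] lead from there to the last cut with the same values
   on both sides.  The outer prefix [z] satisfies [z p u = z p], and [z] cancels
   because [z p] and [p] generate the same ideal. *)

Set Implicit Arguments.
Unset Strict Implicit.
Unset Printing Implicit Defensive.

(** * Games on words *)

Section Game.
Variable B : Type.
Implicit Types (w x y u v : seq B) (i k : nat).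

(** One move of the challenger, made in [w]: the answer in [w'] bears the same letter, and [R]
    governs the continuation on either side of it. *)
Definition fwd (R : seq B -> seq B -> Prop) w w' : Prop :=
  forall x a y, w = x ++ a :: y ->
  exists x' y', [/\ w' = x' ++ a :: y', R x x' & R y y'].

(* Ehrenfeucht-Fraisse game with [k] rounds for [Sigma_i], without valuations:
   a chosen position splits the word, and by composition the two players may go
   on independently in the two factors. *)
Fixpoint game i k w w' : Prop :=
  if k is k'.+1 then
    (0 < i -> fwd (game i k') w w') /\ (1 < i -> fwd (game i.-1 k') w' w)
  else True.

Lemma fwd_sub (R S : seq B -> seq B -> Prop) w w' :
  (forall x y, R x y -> S x y) -> fwd R w w' -> fwd S w w'.
Proof.
move=> sub f x a y /f[x' [y' [-> rx ry]]].
by exists x', y'; split=> //; apply: sub.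
Qed.

Lemma gameW i k w w' : game i k.+1 w w' -> game i k w w'.
Proof.
elim: k i w w' => // k IH i w w' [h1 h2]; split=> hi.
  by apply: fwd_sub (h1 hi) => x y; apply: IH.
by apply: fwd_sub (h2 hi) => x y; apply: IH.
Qed.

Lemma game_le i k l w w' : k <= l -> game i l w w' -> game i k w w'.
Proof.
move=> /subnK <-; elim: (l - k) => // m IH; rewrite addSn => /gameW; exact: IH.
Qed.

(** Moves in [w'] are the second clause of the game; for moves in [w], reversing twice lowers the
    level by two, as the reversed game asks. *)
Lemma game_rev i k w w' : game i k w w' -> game i.-1 k w' w.
Proof.
elim: k i w w' => // k IH [|i] w w' //= [h1 h2]; split=> hi.
  exact: h2.
by apply: fwd_sub (h1 isT) => x y /IH /IH.
Qed.

Lemma game_refl i k w : game i k w w.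
Proof.
by elim: k i w => // k IH i w; split=> _ x a y ->; exists x, y; split.
Qed.

Lemma game_trans i k w2 w1 w3 :
  game i k w1 w2 -> game i k w2 w3 -> game i k w1 w3.
Proof.
elim: k i w1 w2 w3 => // k IH i w1 w2 w3 [h1 h2] [h3 h4]; split=> hi x a y.
  move=> /(h1 hi)[x' [y' [/(h3 hi)[x2 [y2 [-> gx gy]]] gx' gy']]].
  by exists x2, y2; split=> //; apply: IH; eassumption.
move=> /(h4 hi)[x' [y' [/(h2 hi)[x2 [y2 [-> gx gy]]] gx' gy']]].
by exists x2, y2; split=> //; apply: IH; eassumption.
Qed.

Lemma cat_eq_cat_cons x y p a q : x ++ y = p ++ a :: q ->
  (exists2 r, x = p ++ a :: r & q = r ++ y) \/
  (exists2 r, p = x ++ r & y = r ++ a :: q).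
Proof.
elim: x p => [|b x IH] [|c p] //=.
- by move=> ->; right; exists [::].
- by move=> ->; right; exists (c :: p).
- by case=> -> <-; left; exists x.
- by case=> -> /IH[[r -> ->]|[r -> ->]]; [left|right]; exists r.
Qed.

(** A position of a concatenation lies in one of the two factors: the answer is given in that
    factor, and the other one is carried along with one round less. *)
Lemma game_cat i k x x' y y' :
  game i k x x' -> game i k y y' -> game i k (x ++ y) (x' ++ y').
Proof.
elim: k i x x' y y' => // k IH.
have aux j u u' v v' : game j k u u' -> game j k v v' ->
    fwd (game j k) u u' -> fwd (game j k) v v' ->
    fwd (game j k) (u ++ v) (u' ++ v').
  move=> g1 g2 f1 f2 p a q /cat_eq_cat_cons[[r eu ->]|[r -> ev]].
    have [p' [r' [-> gp gr]]] := f1 _ _ _ eu.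
    by exists p', (r' ++ v'); split=> //; [rewrite -catA | apply: IH].
  have [p' [r' [-> gp gr]]] := f2 _ _ _ ev.
  by exists (u' ++ p'), r'; split=> //; [rewrite -catA | apply: IH].
move=> i x x' y y' gx gy; move: (gameW gx) (gameW gy) => gx' gy'.
case: gx gy => [h1 h2] [h3 h4].
split=> hi; first by apply: aux => //; [apply: h1 | apply: h3].
by apply: aux; [apply: game_rev| apply: game_rev| apply: h2| apply: h4].
Qed.

(** The extra round is spent on the last letter of [x]: the answer to it shows where to cut [w]. *)
Lemma game_split i k x y w : 0 < i -> game i k.+1 (x ++ y) w ->
  exists x' y', [/\ w = x' ++ y', game i k x x' & game i k y y'].
Proof.
move=> hi; elim/last_ind: x y w => [|x a _] y w g.
  by exists [::], w; split=> //; [apply: game_refl | apply: gameW].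
case: g => /(_ hi x a y)[|x' [y' [-> gx gy]] _]; first by rewrite cat_rcons.
exists (rcons x' a), y'; split=> //; first by rewrite cat_rcons.
by rewrite -!cats1; apply: game_cat => //; apply: game_refl.
Qed.

(** * Powers of a word and pumping *)

Definition pow v n : seq B := flatten (nseq n v).

Lemma powD v m n : pow v (m + n) = pow v m ++ pow v n.
Proof. by rewrite /pow nseqD flatten_cat. Qed.

Lemma pow1 v : pow v 1 = v.
Proof. by rewrite /pow /= cats0. Qed.

Lemma pow_split v n x a y : pow v n = x ++ a :: y ->
  exists n1 n2 v1 v2, [/\ n = n1 + n2.+1, v = v1 ++ a :: v2,
    x = pow v n1 ++ v1 & y = v2 ++ pow v n2].
Proof.
elim: n x y => [|n IH] x y; first by case: x.
rewrite -add1n powD pow1 => /cat_eq_cat_cons[[r ev ->]|[r -> /IH]].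
  by exists 0, n, x, r.
move=> [n1 [n2 [v1 [v2 [-> ev -> ->]]]]].
exists n1.+1, n2, v1, v2; split=> //.
by rewrite -(add1n n1) powD pow1 catA.
Qed.

(** Equality up to the threshold [2 ^ k - 1], the classical condition for linear orders with [a] and
    [b] elements to agree for [k] rounds. *)
Definition close k (a b : nat) := (a == b) || (2 ^ k <= a.+1) && (2 ^ k <= b.+1).

Lemma close_split k a1 a2 b : close k.+1 (a1 + a2.+1) b ->
  exists b1 b2, [/\ b = b1 + b2.+1, close k a1 b1 & close k a2 b2].
Proof.
rewrite /close expnS => /orP[/eqP<-|/andP[]].
  by exists a1, a2; rewrite !eqxx.
set N := 2 ^ k => ha hb; have N0 : 0 < N by rewrite /N expn_gt0.
have [h1|h1] := ltnP a1.+1 N.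
  exists a1, (b - a1.+1); rewrite eqxx; split=> //; first lia.
  by apply/orP; right; lia.
have [h2|h2] := ltnP a2.+1 N.
  exists (b - a2.+1), a2; rewrite eqxx; split=> //; first lia.
  by apply/orP; right; lia.
(* Both parts of the left side reach the threshold, so any cut of [b] into two parts that reach it
   will do. *)
exists N.-1, (b - N); split; first lia.
  by apply/orP; right; lia.
by apply/orP; right; lia.
Qed.

Lemma close_sym k a b : close k a b = close k b a.
Proof. by rewrite /close eq_sym andbC. Qed.

Lemma game_pow i k v a b : close k a b -> game i k (pow v a) (pow v b).
Proof.
elim: k i a b => // k IH i.
suff aux j a b : close k.+1 a b -> fwd (game j k) (pow v a) (pow v b).
  by move=> a b c; split=> _; apply: aux => //; rewrite close_sym.
move=> c x l y /pow_split[a1 [a2 [v1 [v2 [ea ev -> ->]]]]].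
move: c; rewrite ea => /close_split[b1 [b2 [-> c1 c2]]].
exists (pow v b1 ++ v1), (v2 ++ pow v b2); split.
- by rewrite powD -add1n powD pow1 [in X in _ ++ X ++ _]ev -!catA.
- by apply: game_cat; [apply: IH | apply: game_refl].
- by apply: game_cat; [apply: game_refl | apply: IH].
Qed.

(** A move in [pow v a] leaves many copies of [v] on at least one side. With many on the left the
    answer is in the block after [u], otherwise in the block before [u], so that [u] always falls on
    a side to which the induction applies. *)
Lemma game_pump i k u v a b c : game i.-1 k u v ->
  2 ^ k <= a.+1 -> 2 ^ k <= b.+1 -> 2 ^ k <= c.+1 ->
  game i k (pow v a) (pow v b ++ u ++ pow v c).
Proof.
elim: k a b c => // k IH a b c g ha hb hc; split=> [hi|].
  move=> x l y /pow_split[a1 [a2 [v1 [v2 [ea ev -> ->]]]]].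
  have cb : close k.+1 (a1 + a2.+1) b by rewrite -ea /close ha hb orbT.
  have cc : close k.+1 (a1 + a2.+1) c by rewrite -ea /close ha hc orbT.
  have [h1|h1] := leqP (2 ^ k) a1.+1.
    have [c1 [c2 [-> q1 q2]]] := close_split cc.
    exists (pow v b ++ u ++ pow v c1 ++ v1), (v2 ++ pow v c2); split.
    - by rewrite powD -add1n powD pow1 [in X in _ ++ _ ++ _ ++ X ++ _]ev -!catA.
    - rewrite !catA -(catA (pow v b)); apply: game_cat (game_refl _ _ _).
      apply: IH => //; first exact: gameW.
        by move: hb; rewrite expnS; lia.
      by move: q1; rewrite /close; lia.
    - by apply: game_cat; [apply: game_refl | apply: game_pow].
  have h2 : 2 ^ k <= a2.+1 by move: ha; rewrite ea expnS; lia.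
  have [b1 [b2 [-> q1 q2]]] := close_split cb.
  exists (pow v b1 ++ v1), (v2 ++ pow v b2 ++ u ++ pow v c); split.
  - by rewrite powD -add1n powD pow1 [in X in (_ ++ X ++ _) ++ _]ev -!catA.
  - by apply: game_cat; [apply: game_pow | apply: game_refl].
  - apply: game_cat; first exact: game_refl.
    apply: IH => //; first exact: gameW.
      by move: q2; rewrite /close; lia.
    by move: hc; rewrite expnS; lia.
move=> hi.
(* A move in the pumped word is played at level [i.-1], where [u] may be replaced by [v]; what
   results is a plain power of [v], long enough to be close to [pow v a]. *)
have : game i.-1 k.+1 (pow v b ++ u ++ pow v c) (pow v a).
  apply: (@game_trans _ _ (pow v (b + (1 + c)))).
    rewrite !powD pow1; apply: game_cat; first exact: game_refl.
    by apply: game_cat => //; apply: game_refl.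
  by apply: game_pow; rewrite /close ha; lia.
by case=> + _; apply; lia.
Qed.

End Game.

Lemma map_eq_cat_cons (S T : Type) (f : S -> T) s x a y :
  map f s = x ++ a :: y ->
  exists s1 p s2, [/\ s = s1 ++ p :: s2, map f s1 = x, f p = a & map f s2 = y].
Proof.
elim: s x => [|p s IH] [|b x] //= [<-].
  by move=> <-; exists [::], p, s.
by move=> /IH[s1 [p' [s2 [-> <- <- <-]]]]; exists (p :: s1), p', s2.
Qed.

Lemma game_map (B C : Type) (f : B -> C) i k w w' :
  game i k w w' -> game i k (map f w) (map f w').
Proof.
elim: k i w w' => // k IH i.
suff aux j w w' : fwd (game j k) w w' -> fwd (game j k) (map f w) (map f w').
  by move=> w w' [h1 h2]; split=> hi; apply: aux; [apply: h1 | apply: h2].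
move=> h x a y e; have [x1 [b [y1 [ew <- <- <-]]]] := map_eq_cat_cons e.
have [x' [y' [-> gx gy]]] := h _ _ _ ew.
by exists (map f x'), (map f y'); rewrite map_cat; split=> //; apply: IH.
Qed.

(** * Levels of formulas *)

(** [m] is the level of the body relative to its own quantifier [q']. The [maxn 1] makes a
    quantifier over a quantifier-free body count as a block; the successor is the block opened when
    [q] differs from [q']. *)
Definition qlev (q q' : quant) (m : nat) : nat :=
  match q, q' with
  | Ex, Ex | All, All => maxn 1 m
  | _, _ => (maxn 1 m).+1
  end.

(* [lev Ex f] (resp. [lev All f]) is the least [i] such that [f] is [Sigma_i]
   (resp. [Pi_i]), read off [f] itself rather than off a prenex form. *)
Fixpoint lev (A : finType) n (q : quant) (f : fo A n) : nat :=
  match f with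
  | Tru _ | Fls _ | Lab _ _ _ | Lt _ _ _ => 0
  | Not _ f => lev (dual q) f
  | And _ f g | Or _ f g => maxn (lev q f) (lev q g)
  | Quant _ q' f => qlev q q' (lev q' f)
  end.

Section Levels.
Variable A : finType.

Lemma dualK q : dual (dual q) = q.
Proof. by case: q. Qed.

Lemma qlev_le q q' m m' : m <= m' -> qlev q q' m <= qlev q q' m'.
Proof. by case: q q' => [] [] /=; lia. Qed.

Lemma lev_dual n q (f : fo A n) : lev q f <= (lev (dual q) f).+1.
Proof.
elim: f q => //= {n} [n f IHf g IHg q|n f IHf g IHg q|n q' f _ q].
- by have := (IHf q, IHg q); case; lia.
- by have := (IHf q, IHg q); case; lia.
- by case: q q' => [] [] /=; lia.
Qed.

Lemma lev_quant n q q' (f : fo A n.+1) : lev q f <= lev q (Quant q' f).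
Proof.
by case: q q' => [] [] /=; have := lev_dual Ex f; have := lev_dual All f => /=; lia.
Qed.

Lemma lev_rename m (f : fo A m) n (r : 'I_m -> 'I_n) q :
  lev q (rename f r) = lev q f.
Proof. by elim: f n r q => //= *; do ?[congr (qlev _ _ _) | congr maxn]; auto. Qed.

Lemma prefix_rename m (f : fo A m) n (r : 'I_m -> 'I_n) :
  Defs.prefix (rename f r) = Defs.prefix f.
Proof. by elim: f n r => //= *; congr (_ :: _); auto. Qed.

Lemma qfree_rename m (f : fo A m) n (r : 'I_m -> 'I_n) :
  qfree (rename f r) = qfree f.
Proof. by elim: f n r => //= *; congr andb; auto. Qed.

Lemma lev_qfree n q (f : fo A n) : qfree f -> lev q f = 0.
Proof.
elim: f q => //= {n} [n f IH q /IH|n f IHf g IHg q /andP[]|n f IHf g IHg q /andP[]] //.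
  by move=> /IHf -> /IHg ->.
by move=> /IHf -> /IHg ->.
Qed.

Lemma lev_connective c n q (f g : fo A n) :
  lev q (connective c f g) = maxn (lev q f) (lev q g).
Proof. by case: c. Qed.

Lemma lev_prenex_not n q (f : fo A n) : lev q (prenex_not f) = lev (dual q) f.
Proof. by elim: f q => //= {n} n q' f IH q; rewrite IH dualK; case: q q' => [] []. Qed.

Lemma lev_prenex_bin c n (f g h : fo A n) q :
  prenex_bin c f g h -> maxn (lev q f) (lev q g) <= lev q h.
Proof.
move=> b; elim: b q => {n f g h}.
- by move=> n f g _ _ q; rewrite lev_connective.
- move=> n q' f g h _ IH q; rewrite geq_max; apply/andP; split=> /=.
    by apply: qlev_le; have := IH q'; rewrite geq_max => /andP[].
  apply: leq_trans (lev_quant q q' h); have := IH q.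
  by rewrite geq_max lev_rename => /andP[].
- move=> n q' f g h _ IH q; rewrite geq_max; apply/andP; split=> /=.
    apply: leq_trans (lev_quant q q' h); have := IH q.
    by rewrite geq_max lev_rename => /andP[].
  by apply: qlev_le; have := IH q'; rewrite geq_max => /andP[].
Qed.

(** Pulling quantifiers out, in whatever order, can only raise the level. This is the half of
    [SigmaP] that starts from an arbitrary prenex form. *)
Lemma lev_prenex_nf n (f h : fo A n) q : prenex_nf f h -> lev q f <= lev q h.
Proof.
move=> p; elim: p q => {n f h}.
- by [].
- by move=> n f h _ IH q; rewrite lev_prenex_not /=.
- move=> c n f g f' g' h _ IHf _ IHg b q; rewrite lev_connective.
  apply: leq_trans (lev_prenex_bin q b).
  by rewrite geq_max !leq_max IHf IHg orbT.
- by move=> n q' f h _ IH q /=; apply: qlev_le.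
Qed.

(** * Prenex forms of optimal level *)

Fixpoint prenex n (f : fo A n) : bool :=
  match f with
  | Quant _ _ f => prenex f
  | f => qfree f
  end.

Lemma qfree_prenex n (f : fo A n) : qfree f -> prenex f.
Proof. by case: f. Qed.

Lemma prenex_rename m (f : fo A m) n (r : 'I_m -> 'I_n) :
  prenex (rename f r) = prenex f.
Proof. by elim: f n r => //= *; rewrite ?qfree_rename; auto. Qed.

Lemma prenex_bin_prenex c n (f g h : fo A n) : prenex_bin c f g h -> prenex h.
Proof. by elim=> // m f' g' hf hg; case: c => /=; apply/andP. Qed.

Lemma prenex_nf_prenex n (f h : fo A n) : prenex_nf f h -> prenex h.
Proof.
elim=> {n f h} //; first by move=> n f; apply: qfree_prenex.
- by move=> n f h _; elim: h {f}.
- by move=> c n f g f' g' h _ _ _ _ /prenex_bin_prenex.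
Qed.

Lemma nblocks_gt0 q s : 0 < nblocks (q :: s).
Proof. by elim: s q => [|q' s IH] [] //; case: q' (IH q'). Qed.

Lemma lev_nblocks n (h : fo A n) : prenex h ->
  lev Ex h = nblocks (Defs.prefix h) +
    (if Defs.prefix h is All :: _ then 1 else 0) /\
  lev All h = nblocks (Defs.prefix h) +
    (if Defs.prefix h is Ex :: _ then 1 else 0).
Proof.
elim: h => {n} //.
- by move=> n f _ hf; rewrite !(@lev_qfree _ _ (Not f)).
- by move=> n f _ g _ hf; rewrite !(@lev_qfree _ _ (And f g)).
- by move=> n f _ g _ hf; rewrite !(@lev_qfree _ _ (Or f g)).
- move=> n q f IH /IH[].
  rewrite -[lev Ex (Quant q f)]/(qlev Ex q (lev q f)).
  rewrite -[lev All (Quant q f)]/(qlev All q (lev q f)).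
  rewrite -[Defs.prefix (Quant q f)]/(q :: Defs.prefix f).
  case: (Defs.prefix f) => [|q' s]; first by case: q => /=; lia.
  have -> : nblocks (q :: q' :: s) = nblocks (q' :: s) +
      (if q' is Ex then if q is Ex then 0 else 1 else if q is Ex then 1 else 0).
    by case: q q' => [] [] /=; lia.
  by have := nblocks_gt0 q' s; case: q q' => [] [] ; move: (nblocks _) => m /=; lia.
Qed.

Lemma prenex_Sigma i n (h : fo A n) : 0 < i -> prenex h ->
  (nblocks (Defs.prefix h) = i /\ ohead (Defs.prefix h) = Some Ex
     \/ nblocks (Defs.prefix h) < i) <->
  lev Ex h <= i.
Proof.
move=> i0 /lev_nblocks[-> _]; case: (Defs.prefix h) => [|[] s].
- by rewrite /=; split; [lia | right].
- rewrite addn0; have := nblocks_gt0 Ex s; case: (nblocks _) => // m _.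
  split=> [[[<- _]|]|h1]; try lia.
  by have [e|ne] := eqVneq i m.+1; [left | right; lia].
- by split=> [[[_ //]|]|h1]; [lia | right; lia].
Qed.

Lemma prenex_noQ n (f : fo A n) : prenex f ->
  qfree f \/ exists q f', f = Quant q f'.
Proof. by case: f => /=; intros; auto; right; do 2 eexists. Qed.

(** Quantifiers [q] are pulled first, from whichever side begins with one; a [dual q] is pulled,
    with bound [i.-1], only when neither side does. Blocks of the two prefixes are thus merged
    instead of stacked. *)
Lemma prenex_bin_ex c n (f g : fo A n) q i : prenex f -> prenex g ->
  lev q f <= i -> lev q g <= i ->
  exists2 h, prenex_bin c f g h & lev q h <= i.
Proof.
have [m] := ubnP (size (Defs.prefix f) + size (Defs.prefix g)).
elim: m n f g q i => // m IH n f g q i hm pf pg lf lg.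
have stepl q' (f' : fo A n.+1) : f = Quant q' f' -> forall j, lev q' f' <= j ->
    lev q' g <= j -> exists2 h, prenex_bin c f' (shift g) h & lev q' h <= j.
  move=> ef j lf' lg'; apply: IH; rewrite ?prefix_rename ?prenex_rename ?lev_rename //.
    by move: hm; rewrite ef /= => hm; lia.
  by move: pf; rewrite ef.
have stepr q' (g' : fo A n.+1) : g = Quant q' g' -> forall j, lev q' f <= j ->
    lev q' g' <= j -> exists2 h, prenex_bin c (shift f) g' h & lev q' h <= j.
  move=> eg j lf' lg'; apply: IH; rewrite ?prefix_rename ?prenex_rename ?lev_rename //.
    by move: hm; rewrite eg /= => hm; lia.
  by move: pg; rewrite eg.
have pulll q' (f' : fo A n.+1) : f = Quant q' f' -> forall j, lev q' f' <= j ->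
    lev q' g <= j -> qlev q q' j <= i -> exists2 h, prenex_bin c f g h & lev q h <= i.
  move=> ef j l1 l2 hj; have [h b lh] := stepl _ _ ef _ l1 l2.
  exists (Quant q' h); first by rewrite ef; apply: PB_left.
  by apply: leq_trans hj => /=; apply: qlev_le.
have pullr q' (g' : fo A n.+1) : g = Quant q' g' -> forall j, lev q' f <= j ->
    lev q' g' <= j -> qlev q q' j <= i -> exists2 h, prenex_bin c f g h & lev q h <= i.
  move=> eg j l1 l2 hj; have [h b lh] := stepr _ _ eg _ l1 l2.
  exists (Quant q' h); first by rewrite eg; apply: PB_right.
  by apply: leq_trans hj => /=; apply: qlev_le.
have same (j : nat) : 0 < j -> j <= i -> qlev q q j <= i by case: (q) => /=; lia.
have diff : 1 < i -> qlev q (dual q) i.-1 <= i by case: (q) => /=; lia.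
have inv q' (k : fo A n.+1) : lev q (Quant q' k) <= i ->
    (q' = q /\ lev q k <= i /\ 0 < i) \/
    (q' = dual q /\ lev (dual q) k <= i.-1 /\ 1 < i).
  by case: (q) q' => [] [] /=; [left|right|right|left]; split=> //; lia.
have qd (k : fo A n) : qfree k -> lev (dual q) k <= i.-1 by move=> /lev_qfree->.
case: (prenex_noQ pf) => [qf|[q1 [f1 ef]]]; case: (prenex_noQ pg) => [qg|[q2 [g1 eg]]].
- exists (connective c f g); first exact: PB_matrix.
  by rewrite lev_connective !lev_qfree.
- have := lg; rewrite [in X in X -> _]eg => /inv[[e2 [l2 i0]]|[e2 [l2 i1]]]; subst q2.
    by apply: (pullr _ _ eg i) => //; apply: same.
  by apply: (pullr _ _ eg i.-1) => //; [apply: qd | apply: diff].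
- have := lf; rewrite [in X in X -> _]ef => /inv[[e1 [l1 i0]]|[e1 [l1 i1]]]; subst q1.
    by apply: (pulll _ _ ef i) => //; apply: same.
  by apply: (pulll _ _ ef i.-1) => //; [apply: qd | apply: diff].
have := lf; rewrite [in X in X -> _]ef => /inv[[e1 [l1 i0]]|[e1 [l1 i1]]]; subst q1.
  by apply: (pulll _ _ ef i) => //; apply: same.
have := lg; rewrite [in X in X -> _]eg => /inv[[e2 [l2 i0]]|[e2 [l2 _]]]; subst q2.
  by apply: (pullr _ _ eg i) => //; apply: same.
apply: (pulll _ _ ef i.-1) => //; last exact: diff.
by rewrite eg; case: (q) l2 => /=; lia.
Qed.

Lemma prenex_nf_ex n (f : fo A n) q :
  exists2 h, prenex_nf f h & lev q h <= lev q f.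
Proof.
elim: f q => {n}.
- by move=> n q; exists Tru => //; apply: PN_qfree.
- by move=> n q; exists Fls => //; apply: PN_qfree.
- by move=> n a x q; exists (Lab a x) => //; apply: PN_qfree.
- by move=> n x y q; exists (Lt A x y) => //; apply: PN_qfree.
- move=> n f IH q; have [h nf lh] := IH (dual q).
  by exists (prenex_not h); [apply: PN_not | rewrite lev_prenex_not].
- move=> n f IHf g IHg q; have [f' nf lf] := IHf q; have [g' ng lg] := IHg q.
  have [h b lh] := @prenex_bin_ex true _ f' g' q (maxn (lev q f) (lev q g))
    (prenex_nf_prenex nf) (prenex_nf_prenex ng)
    (leq_trans lf (leq_maxl _ _)) (leq_trans lg (leq_maxr _ _)).
  by exists h => //; apply: PN_bin nf ng b.
- move=> n f IHf g IHg q; have [f' nf lf] := IHf q; have [g' ng lg] := IHg q.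
  have [h b lh] := @prenex_bin_ex false _ f' g' q (maxn (lev q f) (lev q g))
    (prenex_nf_prenex nf) (prenex_nf_prenex ng)
    (leq_trans lf (leq_maxl _ _)) (leq_trans lg (leq_maxr _ _)).
  by exists h => //; apply: PN_bin nf ng b.
- move=> n q' f IH q; have [h nf lh] := IH q'.
  by exists (Quant q' h); [apply: PN_quant | apply: qlev_le].
Qed.

(** Trades the search for a suitable prenex form for a level computed by recursion, which is what
    the games are compared with. *)
Lemma SigmaP i n (f : fo A n) : 0 < i -> Sigma i f <-> lev Ex f <= i.
Proof.
move=> i0; split=> [[h [nf hp]]|lf].
  apply: leq_trans (lev_prenex_nf Ex nf) _.
  exact/(prenex_Sigma i0 (prenex_nf_prenex nf)).
have [h nf lh] := prenex_nf_ex f Ex; exists h; split=> //.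
by apply/(prenex_Sigma i0 (prenex_nf_prenex nf)); apply: leq_trans lh lf.
Qed.

End Levels.

(** * From games to formulas *)

Section Soundness.
Variable A : finType.

(* A valuation is recorded in the letters: position [p] also carries the set of
   variables with value [p]. *)
Definition mark_at (w : seq A) n (v : n.-tuple 'I_(size w)) (p : 'I_(size w)) :
    A * {set 'I_n} :=
  (tnth (in_tuple w) p, [set x | tnth v x == p]).

Definition mark (w : seq A) n (v : n.-tuple 'I_(size w)) :
    seq (A * {set 'I_n}) :=
  [seq mark_at v p | p <- enum 'I_(size w)].

Definition mark_old n (b : A * {set 'I_n}) : A * {set 'I_n.+1} :=
  (b.1, [set lift ord0 x | x in b.2]).

Definition mark_new n (b : A * {set 'I_n}) : A * {set 'I_n.+1} :=
  (b.1, ord0 |: [set lift ord0 x | x in b.2]).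

Lemma mark_at_cons (w : seq A) n (v : n.-tuple 'I_(size w)) p q :
  mark_at (cons_tuple p v) q =
  (if q == p then @mark_new n else @mark_old n) (mark_at v q).
Proof.
have in_lift (S : {set 'I_n}) (x : 'I_n) :
    (lift ord0 x \in [set lift ord0 y | y in S]) = (x \in S).
  by rewrite mem_imset //; apply: lift_inj.
have ord0_lift (S : {set 'I_n}) : (ord0 \in [set lift ord0 y | y in S]) = false.
  by apply/imsetP => -[y _ /eqP]; rewrite (negbTE (neq_lift _ _)).
rewrite /mark_at /mark_new /mark_old.
case: eqVneq => [->|ne]; congr pair; apply/setP => x.
  case: (unliftP ord0 x) => [y ->|->]; rewrite finset.in_set in_setU1.
    by rewrite in_lift finset.in_set tnthS.
  by rewrite eqxx tnth0 eqxx.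
case: (unliftP ord0 x) => [y ->|->].
  by rewrite finset.in_set in_lift finset.in_set tnthS.
by rewrite ord0_lift finset.in_set tnth0 eq_sym (negbTE ne).
Qed.

Lemma enum_split n (p : 'I_n) : exists s1 s2,
  [/\ enum 'I_n = s1 ++ p :: s2, p \notin s1 & p \notin s2].
Proof.
have pin := mem_enum 'I_n p; have := enum_uniq 'I_n.
case/splitPr: pin => s1 s2; rewrite cat_uniq /= => /and3P[_ /norP[h1 _] /andP[h2 _]].
by exists s1, s2.
Qed.

Lemma mark_split (w : seq A) n (v : n.-tuple 'I_(size w)) p : exists X Y,
  mark v = X ++ mark_at v p :: Y /\
  mark (cons_tuple p v) =
    map (@mark_old n) X ++ mark_new (mark_at v p) :: map (@mark_old n) Y.
Proof.
have [s1 [s2 [e n1 n2]]] := enum_split p.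
exists (map (mark_at v) s1), (map (mark_at v) s2).
rewrite /mark e !map_cat /= mark_at_cons eqxx -!map_comp; split=> //.
congr (_ ++ _ :: _); apply/eq_in_map => q qin; rewrite mark_at_cons ifN //=.
  by apply: contraNneq n1 => <-.
by apply: contraNneq n2 => <-.
Qed.

Lemma mark_inv (w : seq A) n (v : n.-tuple 'I_(size w)) X b Y :
  mark v = X ++ b :: Y -> exists p, mark_at v p = b /\
    mark (cons_tuple p v) = map (@mark_old n) X ++ mark_new b :: map (@mark_old n) Y.
Proof.
move=> e; have [s1 [p [s2 [ep <- <- <-]]]] := map_eq_cat_cons e.
exists p; split=> //; have := enum_uniq 'I_(size w).
rewrite /mark ep cat_uniq /= => /and3P[_ /norP[n1 _] /andP[n2 _]].
rewrite map_cat /= mark_at_cons eqxx -!map_comp.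
congr (_ ++ _ :: _); apply/eq_in_map => q qin; rewrite mark_at_cons ifN //=.
  by apply: contraNneq n1 => <-.
by apply: contraNneq n2 => <-.
Qed.

(** Giving a value to a new variable only relabels the letters on both sides of its position, which
    [game_map] allows; composition then glues the marked words together again. *)
Lemma game_mark_cons i k (w w' : seq A) n (v : n.-tuple 'I_(size w))
    (v' : n.-tuple 'I_(size w')) : 0 < i -> game i k.+1 (mark v) (mark v') ->
  forall p, exists p',
    game i k (mark (cons_tuple p v)) (mark (cons_tuple p' v')).
Proof.
move=> i0 [+ _] p; have [X [Y [e ->]]] := mark_split v p.
move=> /(_ i0 _ _ _ e)[X' [Y' [/mark_inv[p' [_ e']] gX gY]]]; exists p'.
rewrite e' -cat1s -[in X in game _ _ _ X]cat1s.
apply: game_cat; first exact: game_map.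
by apply: game_cat; [apply: game_refl | apply: game_map].
Qed.

(** Puts the order in a form that the game sees: two successive moves locate the two marked
    letters. *)
Lemma mark_lt (w : seq A) n (v : n.-tuple 'I_(size w)) x y :
  tnth v x < tnth v y <->
  exists X b Y c Z, [/\ mark v = X ++ b :: Y ++ c :: Z, x \in b.2 & y \in c.2].
Proof.
split=> [lt|].
  pose s := enum 'I_(size w); pose p := tnth v x; pose q := tnth v y.
  exists (map (mark_at v) (take p s)), (mark_at v p),
    (map (mark_at v) (take (q - p.+1) (drop p.+1 s))), (mark_at v q),
    (map (mark_at v) (drop q.+1 s)); split; last 2 first.
  - by rewrite finset.in_set.
  - by rewrite finset.in_set.
  have szs : size s = size w by rewrite size_enum_ord.
  have nths (r : 'I_(size w)) : nth r s r = r by apply: nth_ord_enum.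
  rewrite /mark -/s -[in LHS](cat_take_drop p s) (drop_nth p (n := p)) ?szs //.
  rewrite nths -[in LHS](cat_take_drop (q - p.+1) (drop p.+1 s)) drop_drop.
  rewrite subnK // (drop_nth q (n := q)) ?szs //.
  by rewrite nths !map_cat /= map_cat.
case=> [X [b [Y [c [Z [e xb yc]]]]]].
have [s1 [p [s2 [ep _ epb es2]]]] := map_eq_cat_cons e.
have [s3 [q [s4 [eq _ eqc _]]]] := map_eq_cat_cons es2.
have ex : tnth v x = p by move: xb; rewrite -epb finset.in_set => /eqP.
have ey : tnth v y = q by move: yc; rewrite -eqc finset.in_set => /eqP.
rewrite ex ey.
have := iota_ltn_sorted 0 (size w); rewrite -val_enum_ord.
rewrite sorted_pairwise; last exact: ltn_trans.
rewrite ep eq map_cat /= map_cat pairwise_cat /= all_cat /=.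
by move=> /and3P[_ _ /andP[/and3P[_ + _] _]].
Qed.

Lemma mark_tnth (w : seq A) n (v : n.-tuple 'I_(size w)) x a :
  tnth (in_tuple w) (tnth v x) = a <->
  exists X b Y, [/\ mark v = X ++ b :: Y, b.1 = a & x \in b.2].
Proof.
split=> [<-|[X [b [Y [/mark_inv[p [<- _]] <-]]]]].
  have [X [Y [e _]]] := mark_split v (tnth v x).
  by exists X, (mark_at v (tnth v x)), Y; rewrite finset.in_set eqxx.
by rewrite finset.in_set => /eqP ->.
Qed.

Lemma game_tnth i k (w w' : seq A) n (v : n.-tuple 'I_(size w))
    (v' : n.-tuple 'I_(size w')) x : 0 < i ->
  game i k.+1 (mark v) (mark v') ->
  tnth (in_tuple w') (tnth v' x) = tnth (in_tuple w) (tnth v x).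
Proof.
move=> i0 [/(_ i0) f _]; apply/mark_tnth.
have /mark_tnth[X [b [Y [e eb xb]]]] := erefl (tnth (in_tuple w) (tnth v x)).
have [X' [Y' [e' _ _]]] := f _ _ _ e.
by exists X', b, Y'.
Qed.

(** Moves in one word only preserve strict inequalities. The converse goes by trichotomy: the
    opposite strict inequality is preserved too, and variables with equal values mark the same
    letter. *)
Lemma game_lt i k (w w' : seq A) n (v : n.-tuple 'I_(size w))
    (v' : n.-tuple 'I_(size w')) x y : 0 < i ->
  game i k.+2 (mark v) (mark v') ->
  (tnth v' x < tnth v' y) = (tnth v x < tnth v y).
Proof.
move=> i0 g.
have mono x1 y1 : tnth v x1 < tnth v y1 -> tnth v' x1 < tnth v' y1.
  move=> /mark_lt[X [b [Y [c [Z [e xb yc]]]]]]; apply/mark_lt.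
  have [/(_ i0) f _] := g.
  have [X' [Y1 [e' _ [/(_ i0) f2 _]]]] := f _ _ _ e.
  have [Y' [Z' [e2 _ _]]] := f2 _ _ _ erefl.
  by exists X', b, Y', c, Z'; rewrite e' e2.
have [lt|] := ltnP (tnth v x) (tnth v y); first exact: mono.
rewrite leq_eqVlt => /orP[/eqP/val_inj exy|/mono]; last first.
  by move=> lt; apply/negbTE; rewrite -leqNgt ltnW.
suff -> : tnth v' x = tnth v' y by rewrite ltnn.
have [X [Y [e _]]] := mark_split v (tnth v x).
have [/(_ i0) f _] := g.
have [X' [Y' [/mark_inv[p [ep _]] _ _]]] := f _ _ _ e.
have h z : (tnth v' z == p) = (tnth v z == tnth v x).
  by have := congr1 (fun b : A * {set 'I_n} => z \in b.2) ep; rewrite !finset.in_set.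
have /eqP -> : tnth v' x == p by rewrite h.
by apply/esym/eqP; rewrite h exy.
Qed.

(** Both implications are proved at once because [Not] exchanges them. The two rounds beyond the
    quantifier rank serve the atoms, as comparing positions takes two moves. A quantifier that asks
    for a move in the other word uses [game_rev]; the bound on the level then makes [i.-1]
    positive. *)
Lemma game_sat n (f : fo A n) i k (w w' : seq A) (v : n.-tuple 'I_(size w))
    (v' : n.-tuple 'I_(size w')) : 0 < i -> qrank f + 2 <= k ->
  game i k (mark v) (mark v') ->
  (lev Ex f <= i -> sat f v -> sat f v') /\
  (lev All f <= i -> sat f v' -> sat f v).
Proof.
elim: f i k w w' v v' => {n}.
- by [].
- by [].
- move=> n a x i [|k] w w' v v' i0 // _ g /=.
  by rewrite (game_tnth _ i0 g).
- move=> n x y i [|[|k]] w w' v v' i0 // _ g /=.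
  by rewrite (game_lt _ _ i0 g).
- move=> n f IH i k w w' v v' i0 hk g /=.
  by have [h1 h2] := IH _ _ _ _ _ _ i0 hk g; split=> hl; apply: contra; auto.
- move=> n f IHf g IHg i k w w' v v' i0 /= hk gm; rewrite !geq_max.
  have [|h1 h2] := IHf _ _ _ _ _ _ i0 _ gm; first by lia.
  have [|h3 h4] := IHg _ _ _ _ _ _ i0 _ gm; first by lia.
  by split=> /andP[l1 l2] /andP[s1 s2]; apply/andP; auto.
- move=> n f IHf g IHg i k w w' v v' i0 /= hk gm; rewrite !geq_max.
  have [|h1 h2] := IHf _ _ _ _ _ _ i0 _ gm; first by lia.
  have [|h3 h4] := IHg _ _ _ _ _ _ i0 _ gm; first by lia.
  by split=> /andP[l1 l2] /orP[s|s]; apply/orP; auto.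
move=> n q f IH i [|k] w w' v v' i0 hk gm; first by rewrite addn2 in hk.
have hk' : qrank f + 2 <= k by rewrite -ltnS; apply: leq_trans hk; rewrite addSn.
have gr := game_rev gm.
case: q hk => /= hk; split=> hl.
- move=> /existsP[p hp]; have [p' gp] := game_mark_cons i0 gm p.
  apply/existsP; exists p'; apply: (IH _ _ _ _ _ _ i0 hk' gp).1 => //; lia.
- move=> /existsP[p hp]; have i1 : 0 < i.-1 by lia.
  have [p' gp] := game_mark_cons i1 gr p.
  apply/existsP; exists p'; apply: (IH _ _ _ _ _ _ i1 hk' gp).1 => //; lia.
- move=> /forallP h; apply/forallP => p; have i1 : 0 < i.-1 by lia.
  have [p' gp] := game_mark_cons i1 gr p.
  apply: (IH _ _ _ _ _ _ i1 hk' gp).2 => //; lia.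
- move=> /forallP h; apply/forallP => p.
  have [p' gp] := game_mark_cons i0 gm p.
  apply: (IH _ _ _ _ _ _ i0 hk' gp).2 => //; lia.
Qed.

Lemma mark_nil (w : seq A) :
  mark (nil_tuple 'I_(size w)) = [seq (a, finset.set0) | a <- w].
Proof.
have e : [seq tnth (in_tuple w) p | p <- enum 'I_(size w)] = w.
  exact: map_tnth_enum.
rewrite -[in RHS]e -map_comp.
apply: eq_map => p /=; congr pair.
by apply/setP => -[].
Qed.

Lemma game_models i k (w w' : seq A) (f : sentence A) : 0 < i ->
  lev Ex f <= i -> qrank f + 2 <= k -> game i k w w' ->
  models w f -> models w' f.
Proof.
move=> i0 hl hk g; apply: (game_sat i0 hk _).1 => //.
by rewrite !mark_nil; apply: game_map.
Qed.

End Soundness.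

(** * From formulas to games *)

Section Hintikka.
Variable A : finType.

Fixpoint splits (w : seq A) : seq (seq A * A * seq A) :=
  if w is a :: w' then
    ([::], a, w') :: [seq (a :: s.1.1, s.1.2, s.2) | s <- splits w']
  else [::].

Lemma mem_splits w x a y : ((x, a, y) \in splits w) = (w == x ++ a :: y).
Proof.
elim: w x => [|b w IH] [|d x] //=.
  rewrite in_cons eqseq_cons [in RHS]eq_sym [(w == y)]eq_sym.
  rewrite !xpair_eqE eqxx /= (_ : (_, _, _) \in _ = false) ?orbF //.
  by apply/mapP => -[].
rewrite in_cons !xpair_eqE /= eqseq_cons -IH.
apply/mapP/andP => [[[[x' a'] y'] hin [-> -> -> ->]] //|[/eqP -> hin]].
by exists (x, a, y).
Qed.

Definition bigAnd n (fs : seq (fo A n)) : fo A n := foldr (@And A n) Tru fs.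
Definition bigOr n (fs : seq (fo A n)) : fo A n := foldr (@Or A n) Fls fs.

Lemma sat_bigAnd (w : seq A) n (v : n.-tuple 'I_(size w)) fs :
  sat (bigAnd fs) v = all (fun f => sat f v) fs.
Proof. by elim: fs => //= f fs ->. Qed.

Lemma sat_bigOr (w : seq A) n (v : n.-tuple 'I_(size w)) fs :
  sat (bigOr fs) v = has (fun f => sat f v) fs.
Proof. by elim: fs => //= f fs ->. Qed.

Lemma lev_bigAnd q n m (S : Type) (g : S -> fo A n) s :
  (forall x, lev q (g x) <= m) -> lev q (bigAnd (map g s)) <= m.
Proof. by move=> h; elim: s => //= x s IH; rewrite geq_max h. Qed.

Lemma lev_bigOr q n m (S : Type) (g : S -> fo A n) s :
  (forall x, lev q (g x) <= m) -> lev q (bigOr (map g s)) <= m.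
Proof. by move=> h; elim: s => //= x s IH; rewrite geq_max h. Qed.

Lemma qrank_bigAnd n m (S : Type) (g : S -> fo A n) s :
  (forall x, qrank (g x) <= m) -> qrank (bigAnd (map g s)) <= m.
Proof. by move=> h; elim: s => //= x s IH; rewrite geq_max h. Qed.

Lemma qrank_bigOr n m (S : Type) (g : S -> fo A n) s :
  (forall x, qrank (g x) <= m) -> qrank (bigOr (map g s)) <= m.
Proof. by move=> h; elim: s => //= x s IH; rewrite geq_max h. Qed.

(* [None] stands for the left, resp. right, end of the word. *)
Definition between n (l h : option 'I_n) : fo A n.+1 :=
  And (if l is Some x then Lt A (lift ord0 x) ord0 else Tru)
      (if h is Some y then Lt A ord0 (lift ord0 y) else Tru).

(** First position inside the interval; [hi] is the first one past it. Both end points are excluded,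
    hence the successor here and none in [hi]. *)
Definition lo (w : seq A) n (v : n.-tuple 'I_(size w)) (l : option 'I_n) : nat :=
  if l is Some x then (tnth v x).+1 else 0.

Definition hi (w : seq A) n (v : n.-tuple 'I_(size w)) (h : option 'I_n) : nat :=
  if h is Some x then tnth v x else size w.

Definition factor (w : seq A) n (v : n.-tuple 'I_(size w)) (l h : option 'I_n) :
  seq A := drop (lo v l) (take (hi v h) w).

Lemma sat_between (w : seq A) n (v : n.-tuple 'I_(size w)) p l h :
  sat (between l h) (cons_tuple p v) = (lo v l <= p < hi v h).
Proof.
rewrite /between /=; congr andb; [case: l | case: h] => //= [x|x|];
by rewrite ?tnthS ?tnth0 ?ltn_ord.
Qed.

(** The new variable [ord0] ends the left interval and starts the right one; the old end points are
    shifted past it. *)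
Definition hint_at n (G : seq A -> option 'I_n.+1 -> option 'I_n.+1 -> fo A n.+1)
    (l h : option 'I_n) (s : seq A * A * seq A) : fo A n.+1 :=
  And (Lab s.1.2 ord0) (And (G s.1.1 (omap (lift ord0) l) (Some ord0))
                            (G s.2 (Some ord0) (omap (lift ord0) h))).

Definition hint_ex n G (w : seq A) (l h : option 'I_n) : fo A n :=
  bigAnd [seq Quant Ex (And (between l h) (hint_at G l h s)) | s <- splits w].

Definition hint_all n G (w : seq A) (l h : option 'I_n) : fo A n :=
  Quant All (Or (Not (between l h)) (bigOr [seq hint_at G l h s | s <- splits w])).

(* [hint Ex i k u l h] holds when the open interval between [l] and [h] beats [u]
   in the game, [hint All i k u l h] when it is beaten by [u]. *)
Fixpoint hint (q : quant) (i k : nat) (w : seq A) n (l h : option 'I_n) {struct k}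
    : fo A n :=
  if k is k'.+1 then
    if q is Ex then
      And (if 0 < i then hint_ex (fun x => hint Ex i k' x (n := n.+1)) w l h else Tru)
          (if 0 < i.-1 then hint_all (fun x => hint All i.-1 k' x (n := n.+1)) w l h
           else Tru)
    else
      And (if 0 < i then hint_all (fun x => hint All i k' x (n := n.+1)) w l h else Tru)
          (if 0 < i.-1 then hint_ex (fun x => hint Ex i.-1 k' x (n := n.+1)) w l h
           else Tru)
  else Tru.

Lemma qrank_hint q i k w n (l h : option 'I_n) : qrank (hint q i k w l h) <= k.
Proof.
elim: k q i w n l h => // k IH q i w n l h.
have hE j : qrank (hint_ex (fun x => hint Ex j k x (n := n.+1)) w l h) <= k.+1.
  apply: qrank_bigAnd => s.
  by case: (l) (h) => [?|] [?|] /=; rewrite !max0n ltnS geq_max !IH.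
have hU j : qrank (hint_all (fun x => hint All j k x (n := n.+1)) w l h) <= k.+1.
  rewrite /hint_all /= ltnS geq_max; apply/andP; split.
    by case: (l) (h) => [?|] [?|].
  by apply: qrank_bigOr => s /=; rewrite max0n geq_max !IH.
case: q => /=; rewrite geq_max; apply/andP; split; by case: ifP.
Qed.

(** The clause for moves in the other word is of the dual kind at level [i.-1], so [lev_dual] brings
    it back to level [i]. *)
Lemma lev_hint q i k w n (l h : option 'I_n) : lev q (hint q i k w l h) <= i.
Proof.
elim: k q i w n l h => [[]|k IH q i w n l h] //.
have hE j : 0 < j -> lev Ex (hint_ex (fun x => hint Ex j k x (n := n.+1)) w l h) <= j.
  move=> j0; apply: lev_bigAnd => s.
  by case: (l) (h) => [?|] [?|] /=; rewrite !max0n !geq_max j0 !IH.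
have hU j : 0 < j -> lev All (hint_all (fun x => hint All j k x (n := n.+1)) w l h) <= j.
  move=> j0; rewrite /hint_all /= geq_max j0 geq_max andTb; apply/andP; split.
    by case: (l) (h) => [?|] [?|].
  by apply: lev_bigOr => s /=; rewrite max0n geq_max !IH.
case: q => /=; rewrite geq_max; apply/andP; split; case: ifP => // i0; auto.
  apply: leq_trans (lev_dual _ _) _; have := hU _ i0 => /=; lia.
apply: leq_trans (lev_dual _ _) _; have := hE _ i0 => /=; lia.
Qed.

Section Semantics.
Variables (w : seq A) (n : nat) (v : n.-tuple 'I_(size w)).
Implicit Types (l h : option 'I_n) (p : 'I_(size w)).

Lemma factor_consl p l :
  factor (cons_tuple p v) (omap (lift ord0) l) (Some ord0) =
  drop (lo v l) (take p w).
Proof. by rewrite /factor /= tnth0; congr drop; case: l => //= x; rewrite tnthS. Qed.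

Lemma factor_consr p h :
  factor (cons_tuple p v) (Some ord0) (omap (lift ord0) h) =
  drop p.+1 (take (hi v h) w).
Proof.
rewrite /factor /= tnth0; congr (drop _ (take _ _)).
by case: h => //= x; rewrite tnthS.
Qed.

Lemma hi_le h : hi v h <= size w.
Proof. by case: h => //= x; apply: ltnW. Qed.

Lemma factor_split p l h : lo v l <= p < hi v h ->
  factor v l h = factor (cons_tuple p v) (omap (lift ord0) l) (Some ord0) ++
    tnth (in_tuple w) p :: factor (cons_tuple p v) (Some ord0) (omap (lift ord0) h).
Proof.
case/andP=> lop phi.
rewrite factor_consl factor_consr; have hle := hi_le h.
have st : size (take (hi v h) w) = hi v h by rewrite size_takel.
rewrite /factor -[in LHS](cat_take_drop p (take (hi v h) w)) take_takel ?(ltnW phi) //.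
rewrite drop_cat size_takel ?(ltnW (ltn_ord p)) //.
set a := tnth (in_tuple w) p; have ea : nth a w p = a by rewrite [RHS](tnth_nth a).
rewrite (drop_nth a (n := p)) ?st // nth_take // ea.
case: ltnP => // ple.
(* The chosen position is the first of the interval, so the left factor is empty. *)
have -> : lo v l = p :> nat by apply/eqP; rewrite eqn_leq lop.
by rewrite subnn drop0 (@drop_oversize _ p (take p w)) // size_take_min geq_minl.
Qed.

Lemma factor_inv l h x a y : factor v l h = x ++ a :: y -> exists2 p : 'I_(size w),
  lo v l <= p < hi v h & [/\ tnth (in_tuple w) p = a,
    factor (cons_tuple p v) (omap (lift ord0) l) (Some ord0) = x &
    factor (cons_tuple p v) (Some ord0) (omap (lift ord0) h) = y].
Proof.
move=> e; have hle := hi_le h.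
have sz : (lo v l + size x < hi v h).
  have := congr1 size e; rewrite size_drop size_takel // size_cat /=; lia.
pose p := Ordinal (leq_trans sz hle).
have hp : lo v l <= p < hi v h by rewrite /= leq_addr sz.
exists p => //; have := factor_split hp; rewrite e => /eqP.
rewrite eqseq_cat.
  by rewrite eqseq_cons => /andP[/eqP <- /andP[/eqP <- /eqP <-]].
by rewrite factor_consl size_drop size_takel ?(ltnW (ltn_ord p)) //= addKn.
Qed.

Variables (G : seq A -> option 'I_n.+1 -> option 'I_n.+1 -> fo A n.+1).
Variable (R : seq A -> seq A -> Prop).
Hypothesis sat_G : forall p x (l' h' : option 'I_n.+1),
  sat (G x l' h') (cons_tuple p v) <-> R x (factor (cons_tuple p v) l' h').

Lemma sat_hint_at p l h s : sat (hint_at G l h s) (cons_tuple p v) <->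
  [/\ tnth (in_tuple w) p = s.1.2,
     R s.1.1 (factor (cons_tuple p v) (omap (lift ord0) l) (Some ord0)) &
     R s.2 (factor (cons_tuple p v) (Some ord0) (omap (lift ord0) h))].
Proof.
rewrite /hint_at /= tnth0; split.
  by case/and3P => /eqP-> /sat_G ? /sat_G.
by case=> -> /sat_G -> /sat_G ->; rewrite eqxx.
Qed.

Lemma sat_hint_ex u l h : sat (hint_ex G u l h) v <-> fwd R u (factor v l h).
Proof.
rewrite /hint_ex sat_bigAnd all_map; split=> [/allP hall x a y eu|f].
  have : (x, a, y) \in splits u by rewrite mem_splits eu.
  move=> /hall /existsP[p /andP[+ /sat_hint_at[/= ea rx ry]]].
  rewrite -[X in is_true X -> _]/(sat (between l h) (cons_tuple p v)) sat_between => hp.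
  rewrite (factor_split hp) ea; do 2 eexists; split; [reflexivity | |] => //.
apply/allP => -[[x a] y]; rewrite mem_splits => /eqP eu.
have [x' [y' [/factor_inv[p hp [ea ex ey]] rx ry]]] := f _ _ _ eu.
apply/existsP; exists p; apply/andP; split.
  by rewrite -[X in is_true X]/(sat (between l h) (cons_tuple p v)) sat_between.
by apply/sat_hint_at; rewrite ex ey.
Qed.

Lemma sat_hint_all u l h : sat (hint_all G u l h) v <->
  fwd (fun x y => R y x) (factor v l h) u.
Proof.
split=> [/forallP hall x a y /factor_inv[p hp [ea ex ey]]|f].
  have /orP[|] := hall p; first by
    rewrite -[X in is_true X -> _]/(~~ sat (between l h) (cons_tuple p v)) sat_between hp.
  rewrite -[X in is_true X -> _]/(sat (bigOr _) (cons_tuple p v)) sat_bigOr.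
  rewrite has_map => /hasP[[[x' a'] y']].
  rewrite mem_splits => /eqP -> /sat_hint_at /=; rewrite ea ex ey => -[<- rx ry].
  by exists x', y'.
apply/forallP => p; apply/orP.
have [hp|nhp] := boolP (lo v l <= p < hi v h); last first.
  by left; rewrite -[X in is_true X]/(~~ sat (between l h) (cons_tuple p v)) sat_between.
right; have [x [y [eu rx ry]]] := f _ _ _ (factor_split hp).
rewrite -[X in is_true X]/(sat (bigOr _) (cons_tuple p v)) sat_bigOr has_map.
apply/hasP; exists (x, tnth (in_tuple w) p, y).
  by rewrite mem_splits eu.
exact/sat_hint_at.
Qed.
End Semantics.

Lemma sat_hint k i u (w : seq A) n (v : n.-tuple 'I_(size w)) l h :
  (sat (hint Ex i k u l h) v <-> game i k u (factor v l h)) /\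
  (sat (hint All i k u l h) v <-> game i k (factor v l h) u).
Proof.
elim: k i u w n v l h => [|k IH] i u w n v l h; first by split.
have hE j := sat_hint_ex (R := game j k)
  (fun p x l h => (IH j x w n.+1 (cons_tuple p v) l h).1) u l h.
have hU j := sat_hint_all (R := fun x y => game j k y x)
  (fun p x l h => (IH j x w n.+1 (cons_tuple p v) l h).2) u l h.
split; split.
- by case/andP=> s1 s2; split=> hi; [move: s1 | move: s2]; rewrite ?hi;
    [move/hE | case: i hi {s1} => // -[] // j _ /= /hU].
- case=> g1 g2; apply/andP; split; case: ifP => // hi.
    by apply/hE; apply: g1.
  by apply/hU; apply: g2; lia.
- by case/andP=> s1 s2; split=> hi; [move: s1 | move: s2]; rewrite ?hi;
    [move/hU | case: i hi {s1} => // -[] // j _ /= /hE].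
- case=> g1 g2; apply/andP; split; case: ifP => // hi.
    by apply/hU; apply: g1.
  by apply/hE; apply: g2; lia.
Qed.

Definition hint_sentence i k (w : seq A) : sentence A := hint Ex i k w None None.

Lemma models_hint i k u w : models w (hint_sentence i k u) <-> game i k u w.
Proof.
have [-> _] := sat_hint k i u (nil_tuple 'I_(size w)) None None.
by rewrite /factor /= take_size drop0.
Qed.

(** [w] satisfies its own Hintikka sentence, which is [Sigma i] of rank at most [k]; hence so does
    [w']. *)
Lemma lesssim_game i k (w w' : seq A) : 0 < i -> lesssim k i w w' -> game i k w w'.
Proof.
move=> i0 h; apply/models_hint; apply: h.
- by apply/SigmaP => //; apply: lev_hint.
- exact: qrank_hint.
- by apply/models_hint; apply: game_refl.
Qed.

Lemma game_lesssim i k (w w' : seq A) : 0 < i -> game i k.+2 w w' -> lesssim k i w w'.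
Proof.
move=> i0 g f /SigmaP hl hk; apply: (game_models i0 _ _ g); first exact: hl.
by rewrite addn2 !ltnS.
Qed.

(* Used only to have finitely many classes of words for each [k]. *)
Fixpoint rank_type (k : nat) : finType :=
  if k is k'.+1 then {set rank_type k' * A * rank_type k'} else unit.

Fixpoint rtype (k : nat) (w : seq A) : rank_type k :=
  match k with
  | 0 => tt
  | k'.+1 => [set t in [seq (rtype k' s.1.1, s.1.2, rtype k' s.2) | s <- splits w]]
  end.

Lemma rtype_game k w w' i : rtype k w = rtype k w' -> game i k w w'.
Proof.
elim: k w w' i => // k IH w w' i.
suff aux u u' j : rtype k.+1 u = rtype k.+1 u' -> fwd (game j k) u u'.
  by move=> e; split=> _; apply: aux.
move=> /setP e x a y eu; have := e (rtype k x, a, rtype k y).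
rewrite !finset.in_set (_ : _ \in _ = true); last first.
  by apply/mapP; exists (x, a, y) => //; rewrite mem_splits eu.
move=> /esym /mapP[[[x' a'] y']]; rewrite mem_splits => /eqP -> [ex -> ey].
by exists x', y'; split=> //; apply: IH.
Qed.

(** There are finitely many types of rank [k]. The defining sentence is the disjunction of the
    Hintikka sentences of one word of [L] for each type met by [L]. *)
Lemma game_closed_definable i k (L : set (seq A)) : 0 < i ->
  (forall w w', game i k w w' -> L w -> L w') -> Sigma_definable i L.
Proof.
move=> i0 closed.
pose f := bigOr [seq (if pselect (exists w, L w /\ rtype k w = t) is left e
   then hint_sentence i k (projT1 (cid e)) else Fls) | t <- enum (rank_type k)].
exists f; split.
  apply/SigmaP => //; apply: lev_bigOr => t.
  by case: pselect => // e; apply: lev_hint.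
apply/seteqP; split=> w /=; rewrite /models sat_bigOr has_map.
  move=> Lw; apply/hasP; exists (rtype k w); first by rewrite mem_enum.
  rewrite /=; case: pselect => [e|]; last by case; exists w.
  case: (cid e) => w' /= [_ e']; apply/models_hint; exact: rtype_game.
move=> /hasP[t _] /=; case: pselect => // e; case: (cid e) => w' /= [Lw' _].
by move=> /models_hint g; apply: closed g Lw'.
Qed.

Lemma definable_game_closed i (L : set (seq A)) : 0 < i -> Sigma_definable i L ->
  exists k, forall w w', game i k w w' -> L w -> L w'.
Proof.
move=> i0 [f [/SigmaP hf ->]]; exists (qrank f + 2) => w w' g /=.
exact: (game_models i0 (hf i0) (leqnn _) g).
Qed.

End Hintikka.

(** * Bounded-depth decomposition of words *)

Local Open Scope group_scope.

Section Decomposition.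
Variables (M : monoidType) (T : finType) (c : M -> T).
Hypothesis c_inj : injective c.
Variables (omega : nat).
Hypothesis omega_gt0 : (0 < omega)%N.
Hypothesis idem : forall s : M, s ^+ omega * s ^+ omega = s ^+ omega.

(** The two-sided ideal [M x M], coded in [T] so that it has a cardinality. *)
Definition ideal (x : M) : {set T} :=
  [set t | `[< exists u v, t = c (u * x * v) >]].

Lemma ideal_mulr x y : ideal (x * y) \subset ideal x.
Proof.
apply/fintype.subsetP => t; rewrite !finset.in_set => /asboolP[u [v ->]].
by apply/asboolP; exists u, (y * v); rewrite !mulgA.
Qed.

Lemma ideal_mull x y : ideal (x * y) \subset ideal y.
Proof.
apply/fintype.subsetP => t; rewrite !finset.in_set => /asboolP[u [v ->]].
by apply/asboolP; exists (u * x), v; rewrite !mulgA.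
Qed.

(** Stability of finite monoids: from [b = u x b v] follows [b = (u x)^n b v^n] for all [n], and for
    [n = omega] the idempotent [(u x)^omega] fixes [b]. *)
Lemma ideal_cancel (x b : M) : #|ideal b| <= #|ideal (x * b)| ->
  exists z, z * (x * b) = b.
Proof.
move=> le; have e : ideal (x * b) = ideal b.
  by apply/eqP; rewrite eqEcard ideal_mull.
have : c b \in ideal (x * b).
  by rewrite e finset.in_set; apply/asboolP; exists 1, 1; rewrite mul1g mulg1.
rewrite finset.in_set => /asboolP[u [v /c_inj eb]].
have iter n : (u * x) ^+ n * b * v ^+ n = b.
  elim: n => [|n IH]; first by rewrite mul1g mulg1.
  rewrite expgSr expgS -[RHS]IH [in RHS]eb.
  by rewrite !mulgA.
exists ((u * x) ^+ omega.-1 * u).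
rewrite -[X in _ * u * (x * X)](iter omega) !mulgA.
rewrite -(mulgA _ u x) -expgSr prednK //.
by rewrite idem iter.
Qed.

(** [P d w] abstracts goodness of [w] after [d] more rounds. The increments in the hypotheses are
    the rounds that each construction spends. *)
Variables (A : Type) (alpha : seq A -> M) (P : nat -> seq A -> Prop).
Hypothesis alpha1 : alpha [::] = 1.
Hypothesis alphaM : forall x y, alpha (x ++ y) = alpha x * alpha y.
Hypothesis PS : forall d x, P d x -> P d.+1 x.
Hypothesis P_nil : P 2 [::].
Hypothesis P_letter : forall a, P 2 [:: a].
Hypothesis P_cat : forall d x y, P d x -> P d y -> P d.+1 (x ++ y).
Hypothesis P_loop : forall d x u y, P d x -> P d y ->
  alpha x * alpha u = alpha x -> alpha u * alpha y = alpha y ->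
  P d.+2 (x ++ u ++ y).

Lemma P_le d e x : (d <= e)%N -> P d x -> P e x.
Proof. by move=> /subnK <-; elim: (e - d)%N => // n IH /IH /PS. Qed.

(** Values to the left and right of each cut of [w], the left one including the value [x] of what
    precedes [w]. The number of pairs bounds the recursion below. *)
Definition cuts (x : M) (w : seq A) : {set T * T} :=
  [set t | `[< exists y z, w = y ++ z /\ t = (c (x * alpha y), c (alpha z)) >]].

Lemma last_cut (x : M) (w : seq A) (t : T * T) : t \in cuts x w ->
  exists u y, [/\ w = u ++ y, t = (c (x * alpha u), c (alpha y)) &
    forall a y', y = a :: y' -> t \notin cuts (x * alpha (rcons u a)) y'].
Proof.
elim: w x => [|a w IH] x.
  rewrite finset.in_set => /asboolP[y [z [/esym/nilP]]].
  rewrite cat_nilp => /andP[/nilP -> /nilP ->] ->.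
  by exists [::], [::].
move=> tin; have [tin'|nin] := boolP (t \in cuts (x * alpha [:: a]) w).
  have [u [y [-> -> h]]] := IH _ tin'.
  exists (a :: u), y; split=> //.
    by rewrite -[a :: u]cat1s alphaM mulgA.
  by move=> b y' /h; rewrite -(mulgA x _ (alpha (rcons _ _))) -alphaM.
move: tin; rewrite finset.in_set => /asboolP[[|b y] [z [ez et]]].
  by exists [::], z; split=> // b y' e; move: ez; rewrite e => -[<- <-].
case/negP: nin; rewrite finset.in_set; case: ez => -> ew; apply/asboolP.
by exists y, z; split=> //; rewrite et -(cat1s b y) alphaM mulgA.
Qed.

Lemma cuts_drop x u y : cuts (x * alpha u) y \subset cuts x (u ++ y).
Proof.
apply/fintype.subsetP => t; rewrite !finset.in_set => /asboolP[y1 [z [-> ->]]].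
by apply/asboolP; exists (u ++ y1), z; rewrite catA alphaM mulgA.
Qed.

(** Induction on the number of pairs in [cuts x w]: passing the last cut that carries a given pair
    removes that pair. In each round, [4 * n] leaves room for a loop (two levels) and for the letter
    after it (one). *)
Lemma decomposition_step d N : (2 <= d)%N ->
  (forall w, (N < #|ideal (alpha w)|)%N -> P d w) ->
  forall n x w, (N <= #|ideal (x * alpha w)|)%N -> (#|cuts x w| <= n)%N ->
  P (d + 1 + 4 * n) w.
Proof.
move=> d2 IHd; elim=> [|n IH] x w hw hc.
  suff : (0 < #|cuts x w|)%N by lia.
  apply/card_gt0P; exists (c (x * alpha [::]), c (alpha w)).
  by rewrite finset.in_set; apply/asboolP; exists [::], w.
have [big|small] := ltnP N #|ideal (alpha w)|.
  by apply: P_le (IHd _ big); lia.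
(* [p] is the shortest prefix of [w] whose ideal is no larger than [N]. *)
have [p [v [ew Pp hp]]] : exists p v, [/\ w = p ++ v, P d.+1 p &
    (#|ideal (alpha p)| <= N)%N].
  have [m hm] : exists m, (#|ideal (alpha (take m w))| <= N)%N.
    by exists (size w); rewrite take_size.
  have ex : exists m, (#|ideal (alpha (take m w))| <= N)%N by exists m.
  case: (ex_minnP ex) => {hm}m hm min.
  exists (take m w), (drop m w); split=> //; first by rewrite cat_take_drop.
  case: m hm min => [|m] hm min; first by rewrite take0; apply: P_le P_nil; lia.
  have Pm : P d (take m w).
    by apply: IHd; rewrite ltnNge; apply/negP => /min; rewrite ltnn.
  have [ltm|gem] := ltnP m (size w); last first.
    by rewrite take_oversize ?(leqW gem) // -(take_oversize gem); apply: PS.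
  have [a _] : exists a : A, True by case: (w) ltm => // a *; exists a.
  rewrite (take_nth a) // -cats1; apply: P_cat => //.
  by apply: P_le (P_letter _).
(* [x p] generates an ideal inside that of [p], and with at least [N] elements; since that of [p]
   has at most [N], the two coincide and [x] can be cancelled. *)
have Np : (N <= #|ideal (x * alpha p)|)%N.
  apply: leq_trans hw _; rewrite ew alphaM mulgA.
  exact: subset_leq_card (ideal_mulr _ _).
have [z ez] := @ideal_cancel x (alpha p) (leq_trans hp Np).
have tin : (c (x * alpha p), c (alpha v)) \in cuts (x * alpha p) v.
  by rewrite finset.in_set; apply/asboolP; exists [::], v; rewrite alpha1 mulg1.
have [u [y [ev [/c_inj exu /c_inj euv] hy]]] := last_cut tin.
(* Equal left values mean [x p u = x p]; multiplying by [z] removes [x]. *)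
have fixp : alpha p * alpha u = alpha p.
  by rewrite -{1}ez -!mulgA [X in z * X]mulgA -exu.
have fixy : alpha u * alpha y = alpha y by rewrite -alphaM -ev.
suff Py : P (d + 3 + 4 * n) y.
  have -> : (d + 1 + 4 * n.+1 = (d + 3 + 4 * n).+2)%N by lia.
  by rewrite ew ev; apply: P_loop => //; apply: P_le Pp; lia.
case: y ev hy fixy euv => [|a y] ev hy fixy euv; first by apply: P_le P_nil; lia.
have -> : (d + 3 + 4 * n = (d + 2 + 4 * n).+1)%N by lia.
rewrite -cat1s; apply: P_cat; first by apply: P_le (P_letter _); lia.
suff : P (d + 1 + 4 * n) y by apply: P_le; lia.
have ewy : w = (p ++ rcons u a) ++ y by rewrite ew ev -cats1 -!catA.
apply: (IH (x * alpha (p ++ rcons u a))).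
  by rewrite -mulgA -alphaM -ewy.
(* The pair of the cut after [p] is lost: [u] reaches the last cut of [v] that carries it, and the
   letter [a] lies beyond. *)
suff : (#|cuts (x * alpha (p ++ rcons u a)) y| < #|cuts x w|)%N by lia.
apply/proper_card/properP; split; first by rewrite ewy cuts_drop.
exists (c (x * alpha p), c (alpha v)).
  by rewrite finset.in_set; apply/asboolP; exists p, v.
by rewrite alphaM mulgA; apply: hy.
Qed.

(** Downward induction on the size [N] of ideals, starting above [#|T|], where no word qualifies. *)
Lemma decomposition : exists d, forall w, P d w.
Proof.
suff [d [_ h]] : exists d, (2 <= d)%N /\
    forall w, (0 <= #|ideal (alpha w)|)%N -> P d w.
  by exists d => w; apply: h.
suff down N m : (m + N = #|T|.+1)%N -> exists d, (2 <= d)%N /\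
    forall w, (N <= #|ideal (alpha w)|)%N -> P d w.
  by apply: (down 0%N #|T|.+1); rewrite addn0.
elim: m N => [|m IH] N e.
  exists 2%N; split=> // w; rewrite -[N]add0n e => hw.
  by have := leq_trans hw (max_card _); rewrite ltnn.
have [|d [d2 hd]] := IH N.+1; first by lia.
exists (d + 1 + 4 * #|{: T * T}|)%N; split; first by lia.
move=> w hw; apply: (decomposition_step d2 hd (x := 1)); rewrite ?mul1g //.
exact: max_card.
Qed.

End Decomposition.

(** * The syntactic ordered monoid *)

Section Main.
Variables (A : finType) (L : set (seq A)).
Notation alpha := (synt_morph L).

(** The action of a word on the states of an automaton determines its class, so the monoid embeds
    into the maps from [Q] to [Q]. *)
Lemma synt_finite : regular L -> exists (T : finType) (c : synt L -> T), injective c.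
Proof.
case=> Q [q0 [delta [F eL]]].
have inL w : L w <-> F (foldl delta q0 w) by rewrite {1}eL.
exists {ffun Q -> Q}, (fun s => [ffun q => foldl delta q (repr s)]) => s s' /ffunP e.
rewrite -(synt_morph_repr s) -(synt_morph_repr s').
have fe q : foldl delta q (repr s) = foldl delta q (repr s').
  by have := e q; rewrite !ffunE.
by apply/synt_morphE; split=> u v /inL h; apply/inL; move: h; rewrite !foldl_cat fe.
Qed.

Lemma synt_leMl (x y z : synt L) : (x <= y)%O -> (z * x <= z * y)%O.
Proof.
rewrite -(synt_morph_repr x) -(synt_morph_repr y) -(synt_morph_repr z).
rewrite -!synt_morphM => /synt_leP h; apply/synt_leP.
exact: syn_le_cat (@syn_le_refl _ _ _) h.
Qed.

Lemma synt_leMr (x y z : synt L) : (x <= y)%O -> (x * z <= y * z)%O.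
Proof.
rewrite -(synt_morph_repr x) -(synt_morph_repr y) -(synt_morph_repr z).
rewrite -!synt_morphM => /synt_leP h; apply/synt_leP.
exact: syn_le_cat h (@syn_le_refl _ _ _).
Qed.

Lemma synt_leM (x x' y y' : synt L) :
  (x <= x')%O -> (y <= y')%O -> (x * y <= x' * y')%O.
Proof. by move=> h1 h2; apply: Order.le_trans (synt_leMr _ h1) (synt_leMl _ h2). Qed.

Lemma synt_morph_pow w n : alpha (pow w n) = alpha w ^+ n.
Proof.
elim: n => [|n IH]; first by rewrite synt_morph1.
by rewrite -add1n powD pow1 synt_morphM IH expgS.
Qed.

Definition game_pair i k (t s : synt L) : Prop :=
  exists u v, [/\ game i k u v, alpha u = t & alpha v = s].

Lemma chains_pairP i (t s : synt L) :
  chains alpha i [:: t; s] <-> forall k, game_pair i k t s.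
Proof.
case: i => [|i] /=.
  (* At level 0 neither player has a move to answer, so any two representatives form a pair, in
     accordance with the convention on chains. *)
  split=> // _ k; exists (repr t), (repr s); rewrite !synt_morph_repr; split=> //.
  by case: k => //= k; split.
split=> [h k|h k _].
  have [ws [les]] := h k I; case: ws les => [|u [|v [|]]] //= les [eu ev].
  exists u, v; split=> //; apply: lesssim_game => //; exact: (les 0%N).
have [u [v [g eu ev]]] := h k.+2; exists [:: u; v] => /=; rewrite eu ev; split=> //.
by case=> [_|[|j]] //=; apply: game_lesssim.
Qed.

(** Each pair outside the limit fails at some rank; as there are finitely many pairs, the maximum of
    chosen failing ranks works for all. *)
Lemma game_pair_stable i : regular L -> exists k, forall t s : synt L,
  game_pair i k t s -> forall m, game_pair i m t s.
Proof.
move=> /synt_finite[T [c c_inj]].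
pose bad (p : T * T) k := forall t s, c t = p.1 -> c s = p.2 -> ~ game_pair i k t s.
have ex (p : T * T) : exists k, forall t s, c t = p.1 -> c s = p.2 ->
    game_pair i k t s -> forall m, game_pair i m t s.
  have [[k hk]|nb] := pselect (exists k, bad p k).
    by exists k => t s et es /(hk _ _ et es).
  exists 0%N => t s et es _ m; apply: contrapT => nm; apply: nb; exists m.
  by move=> t' s' et' es'; rewrite -(c_inj _ _ (etrans et (esym et')))
    -(c_inj _ _ (etrans es (esym es'))).
pose k p := projT1 (cid (ex p)).
exists (\max_p k p) => t s [u [v [g eu ev]]].
apply: (projT2 (cid (ex (c t, c s)))) => //.
exists u, v; split=> //; apply: game_le g; exact: (leq_bigmax (c t, c s)).
Qed.

(** * The inequality and definability *)

Variables (i omega : nat).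
Hypothesis i_gt0 : (0 < i)%N.
Hypothesis omega_gt0 : (0 < omega)%N.
Hypothesis idem : forall s : synt L, s ^+ omega * s ^+ omega = s ^+ omega.

Lemma idem_exp (s : synt L) n : (0 < n)%N -> s ^+ (omega * n) = s ^+ omega.
Proof.
case: n => // n _; rewrite expgnA; elim: n => [|n IH]; first by rewrite expg1.
by rewrite expgS IH idem.
Qed.

(** [omega * 2 ^ k] copies of [v] are enough for [game_pump] and still have the value [s ^+ omega];
    closure of [L] under the game is then applied in an arbitrary context. *)
Lemma definable_ineq (t s : synt L) : Sigma_definable i L ->
  (forall k, game_pair i.-1 k t s) ->
  (s ^+ omega <= s ^+ omega * t * s ^+ omega)%O.
Proof.
move=> /(definable_game_closed i_gt0)[k closed] /(_ k)[u [v [g <- <-]]].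
have N0 : (0 < 2 ^ k)%N by rewrite expn_gt0.
have hN : (2 ^ k <= (omega * 2 ^ k).+1)%N.
  by apply: leqW; rewrite leq_pmull.
rewrite -(idem_exp _ N0) -synt_morph_pow; set w := pow v _.
have -> : alpha w * alpha u * alpha w = alpha (w ++ u ++ w).
  by rewrite !synt_morphM mulgA.
apply/synt_leP => x y; apply: closed.
apply: game_cat (game_refl _ _ _) _; apply: game_cat _ (game_refl _ _ _).
exact: game_pump.
Qed.

Hypothesis ineq : forall t s : synt L, (forall k, game_pair i.-1 k t s) ->
  (s ^+ omega <= s ^+ omega * t * s ^+ omega)%O.

(** This is the property called good in the opening overview. *)
Definition respects k w := forall w', game i k w w' -> (alpha w <= alpha w')%O.

Lemma respects_le k m w : (k <= m)%N -> respects k w -> respects m w.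
Proof. by move=> le h w' /(game_le le) /h. Qed.

Lemma respects_cat k x y : respects k x -> respects k y -> respects k.+1 (x ++ y).
Proof.
move=> hx hy w' /(game_split i_gt0)[x' [y' [-> gx gy]]].
by rewrite !synt_morphM; apply: synt_leM; [apply: hx | apply: hy].
Qed.

(** For [i = 1] every pair is a chain of level 0, in particular [(t, 1)]. *)
Lemma one_le (t : synt L) : i = 1%N -> ((1 : synt L) <= t)%O.
Proof.
move=> i1; have := @ineq t 1; rewrite expg1n mul1g mulg1; apply.
by apply/chains_pairP; rewrite i1.
Qed.

Lemma respects_nil : respects 2 [::].
Proof.
move=> w'; have [i1 _|i1] := eqVneq i 1%N; first exact: one_le.
case=> _ /(_ ltac:(lia)); case: w' => // a w' /(_ [::] a w' erefl).
by case=> x [y [] /esym /nilP]; rewrite cat_nilp andbF.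
Qed.

Lemma respects_letter a : respects 2 [:: a].
Proof.
move=> w'; have [i1|i1] := eqVneq i 1%N.
  case=> /(_ i_gt0 [::] a [::] erefl)[x [y [-> _ _]]] _.
  rewrite -[[:: a]]cat0s -[X in (_ <= alpha (_ ++ X))%O]cat1s.
  rewrite !synt_morphM; apply: synt_leM; first exact: one_le.
  rewrite -{1}[alpha [:: a]]mulg1; apply: synt_leMl; exact: one_le.
(* The first clause finds [a] in [w']; the second, played at that position, leaves [x] and [y]
   against empty words, and the last round shows that they are empty. *)
case=> [/(_ i_gt0 [::] a [::] erefl)[x [y [-> _ _]]]].
move=> /(_ ltac:(lia) x a y erefl)[x' [y' [e gx gy]]].
have i2 : (0 < i.-1)%N by lia.
have {}e : x' = [::] /\ y' = [::].
  by case: x' e {gx} => [[<-]//|b x'] [] _ /esym /nilP; rewrite cat_nilp andbF.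
case: e gx gy => -> -> gx gy.
have nil_of (z : seq A) : game i.-1 1 z [::] -> z = [::].
  case: z => // b z [/(_ i2 [::] b z erefl)[x1 [y1 [/esym /nilP]]]].
  by rewrite cat_nilp andbF.
by rewrite (nil_of _ gx) (nil_of _ gy).
Qed.

Lemma respects_loop k x u y :
  (forall t s, game_pair i.-1 k t s -> forall m, game_pair i.-1 m t s) ->
  respects k x -> respects k y ->
  alpha x * alpha u = alpha x -> alpha u * alpha y = alpha y ->
  respects k.+2 (x ++ u ++ y).
Proof.
move=> stable hx hy xu uy w'.
move=> /(game_split i_gt0)[x' [z [-> gx /(game_split i_gt0)[u' [y' [-> gu gy]]]]]].
have xs n : alpha x * alpha u ^+ n = alpha x.
  by elim: n => [|n IH]; rewrite ?mulg1 // expgS mulgA xu.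
have sy n : alpha u ^+ n * alpha y = alpha y.
  by elim: n => [|n IH]; rewrite ?mul1g // expgSr -mulgA uy.
rewrite !synt_morphM uy.
(* Reversing the game on [u] drops the level to [i.-1], so [u'] and [u] form a pair at rank [k],
   hence at every rank. *)
have le : (alpha u ^+ omega <= alpha u ^+ omega * alpha u' * alpha u ^+ omega)%O.
  apply: ineq; apply: stable; exists u', u; split=> //; exact: game_rev.
(* Powers of [u] are absorbed by [x] and by [y], so they can be inserted for the inequality and
   removed after it. *)
rewrite -{1}(xs omega) -mulgA.
apply: Order.le_trans (synt_leMl _ (synt_leMr _ le)) _.
rewrite -!mulgA sy (mulgA (alpha x)) xs.
apply: synt_leM; first by apply: hx; apply: gameW.
by apply: synt_leMl; apply: hy.
Qed.

Lemma ineq_definable : regular L -> Sigma_definable i L.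
Proof.
move=> reg; have [k0 stable] := game_pair_stable i.-1 reg.
have [T [c c_inj]] := synt_finite reg.
(* Ranks are counted from [k0], so that [stable] is available at every depth. *)
have [d hd] : exists d, forall w, respects (k0 + d) w.
  apply: (decomposition c_inj omega_gt0 idem (alpha := alpha)) => //.
  - exact: synt_morphM.
  - by move=> d x; apply: respects_le; rewrite addnS.
  - by apply: respects_le respects_nil; rewrite leq_addl.
  - by move=> a; apply: respects_le (@respects_letter a); rewrite leq_addl.
  - by move=> d x y; rewrite addnS; apply: respects_cat.
  move=> d x u y; rewrite !addnS; apply: respects_loop => t s g.
  case: g => p [q [g ep eq]]; apply: stable.
  by exists p, q; split=> //; apply: game_le g; rewrite leq_addr.
apply: (@game_closed_definable _ i (k0 + d)) => // w w' /hd /synt_leP /(_ [::] [::]).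
by rewrite !cats0.
Qed.
End Main.

Theorem theorem6p3 (A : finType) (i : nat) (hi : (1 <= i)%N)
    (L : set (seq A)) (hL : regular L)
    (omega : nat) (homega : (1 <= omega)%N)
    (hidem : forall s : synt L, s ^+ omega * s ^+ omega = s ^+ omega) :
  Sigma_definable i L <->
  (forall t s : synt L, chains (synt_morph L) i.-1 [:: t; s] ->
     (s ^+ omega <= s ^+ omega * t * s ^+ omega)%O).
Proof.
split=> [def t s /chains_pairP|ineq]; first exact: definable_ineq.
by apply: (ineq_definable hi homega hidem) => // t s /chains_pairP /ineq.
Qed.
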